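(* Let $p\ge 2$ be an integer. Then $p$ is prime if and only if, for every positive integer $n$, $$B(n(p-1),p-1)\equiv -1 \pmod p.$$
   Context: For positive integers $m,n$, $B(m,n)=n!\,S(m,n)$, where $S(m,n)$ denotes the Stirling number of the second kind. *)

(* Defs.v *)
From mathcomp Require Import all_boot all_order all_algebra.

Set Implicit Arguments.
Unset Strict Implicit.
Unset Printing Implicit Defensive.

(* [partition] excludes empty blocks, so this counts the partitions of an
   m-element set into exactly n nonempty blocks. *)
Definition stirling2 (m n : nat) : nat :=
  #|[set P : {set {set 'I_m}} | partition P [set: 'I_m] & #|P| == n]|.

Definition B (m n : nat) : nat := n`! * stirling2 m n.

(* Main.v *)
Require Import Defs.
From mathcomp Require Import all_boot all_order all_algebra.
From mathcomp Require Import cyclic.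

(** [B m i] counts the surjections from an [m]-set onto an [i]-set, and a
function from an [m]-set to a [k]-set is a choice of its image followed by a
surjection onto it, so [k ^ m] is the sum over [i] of ['C(k, i) * B m i]
([expn_sum_bin_B]).

Let [p] be prime and [m = n (p - 1)] with [n > 0]. By Fermat's little theorem
[k ^ m] is congruent mod [p] to 0 for [k = 0] and to 1 for [0 < k < p]. Hence,
mod [p] and at indices below [p], the binomial transform of [B m] is the
sequence 0, 1, 1, 1, ... This is also the binomial transform of
[i |-> (i == 0) - (-1) ^ i], because the alternating sum of row [k] of Pascal's
triangle is [(1 - 1) ^ k]. A binomial transform is unitriangular, hence
injective, so [B m i] is [- (-1) ^ i] mod [p] for [0 < i < p] ([B_mod_prime]).
For [i = p - 1] this is -1: the sign is clear when [p] is odd, and 1 = -1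
mod 2.

Conversely, [B (p - 1) (p - 1)] is a multiple of [(p - 1)!]. A divisor [d < p]
of [p] divides [(p - 1)!], so if [p] also divides [B (p - 1) (p - 1) + 1] then
[d] divides 1 ([prime_dvd_factM_add1]): this is the easy half of Wilson's
theorem, and the case [n = 1] of the congruence suffices. *)

Lemma preim_partition_eqP (T rT : finType) (f : T -> rT) (P : {set {set T}}) :
  partition P [set: T] ->
  reflect (forall x y, (f x == f y) = (pblock P x == pblock P y))
          (preim_partition f [set: T] == P).
Proof.
move=> partP; apply: (iffP eqP) => [defP x y | eq_f].
  have [/eqP covP tiP _] := and3P partP.
  rewrite eq_pblock ?covP ?inE // -defP pblock_equivalence_partition ?inE //.
  by split=> // /eqP->.
rewrite -[RHS](preim_partition_pblock partP); apply: eq_imset => x.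
by apply/setP=> y; rewrite !inE eq_f.
Qed.

(** A function whose fibres are the blocks of [P] is the same thing as an
injection of [P], seen as a finite type of blocks, into the codomain. *)
Lemma card_preim_partition (T rT : finType) (P : {set {set T}}) :
  partition P [set: T] ->
  #|[set f : {ffun T -> rT} | preim_partition f [set: T] == P]|
    = #|rT| ^_ #|P|.
Proof.
move=> partP; have [/eqP covP tiP nP0] := and3P partP.
have blockP x : pblock P x \in P by rewrite pblock_mem // covP inE.
pose block x : {A | A \in P} := Sub (pblock P x) (blockP x).
(* Choose a representative in each block; blocks are nonempty. *)
have [point pointK] : exists pt : {A | A \in P} -> T, cancel pt block.
  apply: (fin_all_exists (P := fun A x => block x = A)) => -[A PA].
  have /set0Pn[x Ax]: A != set0 by apply: contraNneq nP0 => <-.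
  by exists x; apply: val_inj; apply: def_pblock.
rewrite -[#|P|]card_sig -card_inj_ffuns.
pose lift (g : {ffun {A | A \in P} -> rT}) := [ffun x => g (block x)].
rewrite -(@card_in_imset _ _ lift) => [|g h _ _ /ffunP eq_gh]; last first.
  by apply/ffunP=> A; have:= eq_gh (point A); rewrite !ffunE pointK.
apply: eq_card => f; rewrite inE; apply/(preim_partition_eqP _ _ f P partP)/imsetP.
  move=> eq_f; exists [ffun A => f (point A)].
    rewrite inE; apply/injectiveP=> A A'; rewrite !ffunE => /eqP.
    rewrite eq_f => /eqP eqA; rewrite -[A]pointK -[A']pointK.
    exact: val_inj.
  apply/ffunP=> x; rewrite !ffunE; apply/eqP; rewrite eq_f.
  by have /(congr1 val) /= -> := pointK (block x).
case=> g; rewrite inE => /injectiveP inj_g -> x y.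
by rewrite !ffunE (inj_eq inj_g) -val_eqE.
Qed.

(** Sort the functions from an [m]-set to a [k]-set by their partition into
fibres, and these partitions by their number [i] of blocks: each of them comes
from [k ^_ i] functions, which is [i] factorial times ['C(k, i)]. *)
Lemma expn_sum_bin_B (m k : nat) : k ^ m = \sum_(i < k.+1) 'C(k, i) * B m i.
Proof.
pose kernel (f : {ffun 'I_m -> 'I_k}) := preim_partition f [set: 'I_m].
have card_kernel (f : {ffun 'I_m -> 'I_k}) : #|kernel f| < k.+1.
  have partK : partition (kernel f) setT by apply: preim_partitionP.
  have: 0 < #|[set g : {ffun 'I_m -> 'I_k} | kernel g == kernel f]|.
    by apply/card_gt0P; exists f; rewrite inE.
  by rewrite card_preim_partition // card_ord ffact_gt0.
transitivity #|{ffun 'I_m -> 'I_k}|; first by rewrite card_ffun !card_ord.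
rewrite -sum1_card (partition_big (fun f => Ordinal (card_kernel f)) predT) //=.
apply: eq_bigr => i _; rewrite /B mulnA bin_ffact /stirling2 -sum1_card big_distrr /=.
rewrite (partition_big kernel
    [pred P | P \in [set P | partition P [set: 'I_m] & #|P| == i]]) /=; last first.
  by move=> f; rewrite -val_eqE inE preim_partitionP.
apply: eq_bigr => P; rewrite inE => /andP[partP /eqP cardP].
rewrite muln1 -cardP -[k in RHS]card_ord -card_preim_partition // -sum1_card.
apply: eq_bigl => f; rewrite inE -val_eqE /=.
by apply: andb_idl => /eqP->; rewrite cardP.
Qed.

Import GRing.Theory.

(** The transform is unitriangular: [a j] has coefficient ['C(j, j) = 1] in the
[j]-th sum, which otherwise involves only earlier terms. *)
Lemma binomial_transform_inj (R : pzRingType) (N : nat) (a b : nat -> R) :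
  (forall j, j < N -> (\sum_(i < j.+1) a i *+ 'C(j, i) =
                       \sum_(i < j.+1) b i *+ 'C(j, i))%R) ->
  forall j, j < N -> a j = b j.
Proof.
move=> eq_ab; elim/ltn_ind=> j IHj ltjN; have := eq_ab j ltjN.
rewrite !big_ord_recr /= binn (eq_bigr (fun i : 'I_j => b i *+ 'C(j, i))%R).
  exact: addrI.
by move=> i _; rewrite IHj // (ltn_trans _ ltjN).
Qed.

(** The delta at 0 transforms to the constant 1, and [i |-> (-1) ^+ i] to
[j |-> (1 - 1) ^+ j], which is the delta at 0. *)
Lemma binomial_transform_delta_sub_sign (R : pzRingType) (j : nat) :
  (\sum_(i < j.+1) ((i == 0 :> nat)%:R - (-1) ^+ i) *+ 'C(j, i)
    = (0 < j)%:R :> R)%R.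
Proof.
under eq_bigr do rewrite mulrnBl; rewrite sumrB.
have ->: (\sum_(i < j.+1) (-1) ^+ i *+ 'C(j, i) = (1 - 1) ^+ j :> R)%R.
  by rewrite addrC exprD1n.
rewrite big_ord_recl /= bin0 big1 ?addr0 => [|i _]; last by rewrite mul0rn.
by rewrite subrr expr0n; case: j => [|j]; rewrite ?subrr ?subr0.
Qed.

(** Both sides have the same binomial transform below [p]: by
[expn_sum_bin_B] the left one transforms to [j |-> j ^ (n * (p - 1))], which
is 1 for [0 < j < p] by Fermat and 0 for [j = 0] because the exponent is
positive. The value at [i = 0] is included since inverting the transform needs
all the earlier terms. *)
Lemma B_mod_prime (p n i : nat) : prime p -> 0 < n -> i < p ->
  ((B (n * (p - 1)) i)%:R = (i == 0)%:R - (-1) ^+ i :> 'F_p)%R.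
Proof.
move=> p_pr n_gt0; have p_gt1 := prime_gt1 p_pr.
move: i; apply: (binomial_transform_inj 'F_p) => j lt_jp.
rewrite binomial_transform_delta_sub_sign.
transitivity ((j ^ (n * (p - 1)))%:R : 'F_p)%R.
  rewrite expn_sum_bin_B natr_sum; apply: eq_bigr => i _.
  by rewrite natrM mulr_natl.
have [-> | j_gt0] := posnP j.
  by rewrite exp0n // muln_gt0 n_gt0 subn_gt0.
apply/eqP; rewrite -subr_eq0 -natrB ?expn_gt0 ?j_gt0 //.
rewrite -(dvdn_pcharf (pchar_Fp p_pr)) -eqn_mod_dvd ?expn_gt0 ?j_gt0 //.
rewrite mulnC expnM subn1 -totient_prime // -modnXm.
have co_jp : coprime j p by rewrite coprime_sym prime_coprime // gtnNdvd.
by rewrite Euler_exp_totient // modnXm exp1n.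
Qed.

(** The usual argument for Wilson's criterion: a proper divisor of [p] divides
[(p - 1)!], hence also its multiple by [s], and so it divides 1. *)
Lemma prime_dvd_factM_add1 (p s : nat) :
  1 < p -> p %| (p.-1)`! * s + 1 -> prime p.
Proof.
move=> p_gt1 p_dvd; have p_gt0 := ltnW p_gt1.
apply/primeP; split=> // d d_dvd_p; have d_gt0 := dvdn_gt0 p_gt0 d_dvd_p.
have [-> | d_neq_p] := eqVneq d p; first exact: orbT.
have d_lt_p : d < p by rewrite ltn_neqAle d_neq_p dvdn_leq.
have := dvdn_trans d_dvd_p p_dvd.
by rewrite dvdn_addr ?dvdn1 ?orbF // dvdn_mulr // dvdn_fact // d_gt0 -ltnS prednK.
Qed.

Theorem proposition14 (p : nat) (hp : 2 <= p) :
  prime p <->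
  (forall n : nat, 0 < n ->
     ((B (n * (p - 1)) (p - 1))%:Z = - 1%:Z %[mod p%:Z])%Z).
Proof.
have modN1E b : (b%:Z = - 1%:Z %[mod p%:Z])%Z <-> p %| b + 1.
  split; first by move=> /eqP; rewrite eqz_mod_dvd opprK.
  by move=> p_dvd; apply/eqP; rewrite eqz_mod_dvd opprK.
split=> [p_pr n n_gt0 | B_mod]; last first.
  have /modN1E := B_mod 1 isT; rewrite mul1n /B subn1.
  exact: prime_dvd_factM_add1.
apply/modN1E; rewrite (dvdn_pcharf (pchar_Fp p_pr)) natrD.
have p_gt0 := ltnW hp.
rewrite (B_mod_prime p n (p - 1) p_pr n_gt0) subn1 ?ltn_predL //.
rewrite -[p.-1 == 0]negbK -lt0n -ltnS prednK // hp sub0r.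
have [p2 | p_odd] := even_prime p_pr.
  by rewrite p2.
by rewrite -signr_odd -subn1 oddB // p_odd expr0 addNr.
Qed.
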